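(* Let $N\ge 1$ be an integer and let $j\in\{1,\dots,N\}$. Then the Suffridge polynomial $S_{N,j}$ satisfies \[ S_{N,j}(z)= z\,\frac{ N-2(N+1)\cos\left(\frac{j\pi}{N+1}\right)z+(N+2)z^2+(-1)^j z^{N+1}-(-1)^j z^{N+3}}{N\left(1-2\cos\left(\frac{j\pi}{N+1}\right)z+z^2\right)^2} \] as an identity of rational functions in $z$ (equivalently, for every complex $z$ with $1-2\cos\left(\frac{j\pi}{N+1}\right)z+z^2\neq 0$).
   Context: For integers $N\ge 1$ and $1\le j\le N$, the Suffridge polynomial is \[ S_{N,j}(z)= \sum_{k=1}^N \frac{N+1-k}{N}\, \frac{\sin\frac{kj\pi }{N+1}}{\sin\frac{j\pi}{N+1}}\, z^k . \] *)

(* Defs.v *)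
From HB Require Import structures.
From mathcomp Require Import all_boot all_order all_algebra.
From mathcomp Require Import reals trigo complex.

Set Implicit Arguments.
Unset Strict Implicit.
Unset Printing Implicit Defensive.

Import Order.TTheory GRing.Theory Num.Theory.

Local Open Scope ring_scope.
Local Open Scope complex_scope.

(* The embedding of an integral domain into its field of fractions; the
   library's notation for it is local to its own file. *)
Notation "x %:F" := (@FracField.tofrac _ x) : ring_scope.

(* The coefficients are real, but they are embedded in R[i] so that the
   polynomial can be evaluated at complex points. *)
Definition suffridge (R : realType) (N j : nat) : {poly R[i]} :=
  \sum_(1 <= k < N.+1)
    ((N.+1%:R - k%:R) / N%:R
     * (sin (k%:R * j%:R * pi / N.+1%:R)
        / sin (j%:R * pi / N.+1%:R)) : R)%:C *: 'X^k.

(* Main.v *)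
(** Write [s k = sin (k t) / sin t] with [t = j pi / (N+1)] and [D = 1 - 2 c X + X^2]. By the
    recurrence [s (k+2) = 2 c s (k+1) - s k], multiplication by [D] makes the partial sums
    [G n] of the series [sum_k s k X^k] telescope. The weighted sum [sum_(k <= N) (N+1-k) s k X^k]
    is [G 1 + ... + G N], so a second multiplication by [D] makes it telescope too; the boundary
    terms are evaluated by [s (N+1) = 0] and [s (N+2) = - s N = (-1)^j]. *)
Require Import Defs.
From HB Require Import structures.
From mathcomp Require Import all_boot all_order all_algebra.
From mathcomp Require Import reals trigo complex.
From mathcomp Require Import ring.

Set Implicit Arguments.
Unset Strict Implicit.
Unset Printing Implicit Defensive.

Import Order.TTheory GRing.Theory Num.Theory.

Local Open Scope ring_scope.
Local Open Scope complex_scope.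

Section ChebyshevSums.
Variables (A : comNzRingType) (c x : A) (s : nat -> A).
Hypotheses (s0 : s 0%N = 0) (s1 : s 1%N = 1).
Hypothesis s_rec : forall k, s k.+2 = 2 * c * s k.+1 - s k.

(** Induction on [n]: once multiplied out, the new term cancels the old boundary terms through
    [s_rec] and leaves the next pair. An arbitrary commutative ring allows [x] to be the
    indeterminate ['X] later. *)
Lemma chebyshev_sum n :
  (\sum_(1 <= k < n.+1) s k * x ^+ k) * (1 - 2 * c * x + x ^+ 2)
    = x - s n.+1 * x ^+ n.+1 + s n * x ^+ n.+2.
Proof.
elim: n => [|n IHn]; first by rewrite big_geq // s0 s1; ring.
by rewrite big_nat_recr //= mulrDl IHn s_rec !exprS; ring.
Qed.

(** Passing from [n] to [n.+1] raises every weight by one, and the new top term enters with weight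
    one; the increment is thus an unweighted partial sum. *)
Lemma weighted_sum_recr n :
  \sum_(1 <= k < n.+2) (n.+2%:R - k%:R) * s k * x ^+ k
    = \sum_(1 <= k < n.+1) (n.+1%:R - k%:R) * s k * x ^+ k
      + \sum_(1 <= k < n.+2) s k * x ^+ k.
Proof.
rewrite !(big_nat_recr n.+1) //= addrA -big_split /=; congr (_ + _); last first.
  by rewrite -natr1; ring.
by apply: eq_bigr => k _; rewrite -(natr1 n.+1); ring.
Qed.

Lemma weighted_chebyshev_sum n :
  (\sum_(1 <= k < n.+1) (n.+1%:R - k%:R) * s k * x ^+ k)
      * (1 - 2 * c * x + x ^+ 2) ^+ 2
    = x * (n%:R - 2 * n.+1%:R * c * x + n.+2%:R * x ^+ 2)
      + s n.+2 * x ^+ n.+2 - 2 * s n.+1 * x ^+ n.+3 + s n * x ^+ n.+4.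
Proof.
elim: n => [|n IHn].
  by rewrite big_geq // s_rec s0 s1 !exprS; ring.
(* Only one of the two quadratic factors is absorbed by the new partial sum; the other stays as a
   multiplier of its closed form. *)
rewrite weighted_sum_recr mulrDl IHn [(_ + _) ^+ 2]expr2 [X in _ + X]mulrA.
rewrite chebyshev_sum !s_rec !exprS.
by rewrite -!natr1; ring.
Qed.

End ChebyshevSums.

Lemma sin_rec (R : realType) (t : R) (k : nat) :
  sin (k.+2%:R * t) = 2 * cos t * sin (k.+1%:R * t) - sin (k%:R * t).
Proof.
have -> : k.+2%:R * t = k.+1%:R * t + t by rewrite -natr1; ring.
have -> : k%:R * t = k.+1%:R * t - t by rewrite -natr1; ring.
by rewrite sinD sinB; ring.
Qed.

Lemma sin_natpi (R : realType) (j : nat) : sin (j%:R * pi : R) = 0.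
Proof.
elim: j => [|j IHj]; first by rewrite mul0r sin0.
by rewrite -natr1 mulrDl mul1r sinDpi IHj oppr0.
Qed.

Lemma cos_natpi (R : realType) (j : nat) : cos (j%:R * pi : R) = (-1) ^+ j.
Proof.
elim: j => [|j IHj]; first by rewrite mul0r cos0.
by rewrite -natr1 mulrDl mul1r cosDpi IHj exprS mulN1r.
Qed.

(** With denominators cleared, one polynomial identity yields both the fraction-field and the
    pointwise form. *)
Lemma suffridge_mul_sqr (R : realType) (N j : nat) (hj : (1 <= j <= N)%N) :
  let c : R[i] := (cos (j%:R * pi / N.+1%:R : R))%:C in
  suffridge R N j * (N%:R *: (1 - (2 * c) *: 'X + 'X^2) ^+ 2)
    = 'X * (N%:R - (2 * N.+1%:R * c) *: 'X + N.+2%:R *: 'X^2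
            + (-1) ^+ j *: 'X^(N.+1) - (-1) ^+ j *: 'X^(N.+3)).
Proof.
move=> c; have [j_gt0 leqjN] := andP hj.
set t : R := j%:R * pi / N.+1%:R in c *.
have N_neq0 : (N%:R : R) != 0 by rewrite pnatr_eq0 -lt0n (leq_trans j_gt0).
(* Since [0 < j < N.+1], the angle [t] lies strictly between [0] and [pi]. *)
have sint_neq0 : sin t != 0.
  rewrite gt_eqF // sin_gt0_pi // /t; apply/andP; split.
    by rewrite divr_gt0 ?mulr_gt0 ?pi_gt0 ?ltr0n.
  by rewrite ltr_pdivrMr ?ltr0n // mulrC ltr_pM2l ?pi_gt0 // ltr_nat ltnS.
have Nt : N.+1%:R * t = j%:R * pi by rewrite /t mulrC divfK ?pnatr_eq0.
pose r k : R := sin (k%:R * t) / sin t.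
have r_rec k : r k.+2 = 2 * cos t * r k.+1 - r k.
  by rewrite /r sin_rec; field.
have r0 : r 0%N = 0 by rewrite /r mul0r sin0 mul0r.
have r1 : r 1%N = 1 by rewrite /r mul1r divff.
have rN1 : r N.+1 = 0 by rewrite /r Nt sin_natpi mul0r.
have rN2 : r N.+2 = (-1) ^+ j.
  rewrite /r -natr1 mulrDl mul1r Nt sinD sin_natpi cos_natpi mul0r add0r.
  by rewrite mulfK.
(* The recurrence is read backwards: with [r N.+1 = 0] it says [r N.+2 = - r N]. *)
have rN : r N = - (-1) ^+ j by rewrite -rN2 r_rec rN1; ring.
(* Constant polynomials put the coefficients in the same ring as ['X], where the general sum formula
   applies. *)
pose s k : {poly R[i]} := ((r k)%:C)%:P.
have s_rec k : s k.+2 = 2 * c%:P * s k.+1 - s k.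
  by rewrite /s r_rec !rmorphB !rmorphM /= !rmorph_nat.
have sN : s N = - (-1) ^+ j by rewrite /s rN !rmorphN !rmorph_sign.
have sN1 : s N.+1 = 0 by rewrite /s rN1.
have sN2 : s N.+2 = (-1) ^+ j by rewrite /s rN2 !rmorph_sign.
have s0 : s 0%N = 0 by rewrite /s r0.
have s1 : s 1%N = 1 by rewrite /s r1.
have := weighted_chebyshev_sum 'X s0 s1 s_rec N.
rewrite sN sN1 sN2 => W.
have -> : N%:R *: (1 - (2 * c) *: 'X + 'X^2) ^+ 2
    = N%:R * (1 - 2 * c%:P * 'X + 'X^2) ^+ 2 :> {poly R[i]}.
  by rewrite -!mul_polyC !rmorphM /= !rmorph_nat.
rewrite mulrA.
have -> : suffridge R N j * N%:R
    = \sum_(1 <= k < N.+1) (N.+1%:R - k%:R) * s k * 'X^k.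
  rewrite /suffridge mulr_suml; apply: eq_bigr => k _.
  rewrite -!mul_polyC mulrAC; congr (_ * _).
  have -> : k%:R * j%:R * pi / N.+1%:R = k%:R * t by rewrite /t; ring.
  have -> : N%:R = ((N%:R : R)%:C)%:P :> {poly R[i]} by rewrite !rmorph_nat.
  rewrite -!rmorphM /s /=.
  by rewrite mulrAC divfK // -/(r k) 2!rmorphM /= !rmorphB /= !rmorph_nat.
rewrite W -!mul_polyC !rmorphM /= !rmorph_nat !rmorph_sign !exprS.
by ring.
Qed.

Theorem proposition1 (R : realType) (N j : nat)
    (hN : (1 <= N)%N) (hj : (1 <= j <= N)%N) :
  let c : R[i] := (cos (j%:R * pi / N.+1%:R : R))%:C in
  (suffridge R N j)%:F
    = ('X * (N%:R - (2 * N.+1%:R * c) *: 'X + N.+2%:R *: 'X^2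
             + (-1) ^+ j *: 'X^(N.+1) - (-1) ^+ j *: 'X^(N.+3)))%:F
      / (N%:R *: (1 - (2 * c) *: 'X + 'X^2) ^+ 2)%:F
  /\ forall z : R[i], 1 - 2 * c * z + z ^+ 2 != 0 ->
     (suffridge R N j).[z]
       = z * ((N%:R - 2 * N.+1%:R * c * z + N.+2%:R * z ^+ 2
               + (-1) ^+ j * z ^+ N.+1 - (-1) ^+ j * z ^+ N.+3)
              / (N%:R * (1 - 2 * c * z + z ^+ 2) ^+ 2)).
Proof.
move=> c.
have N_neq0 : (N%:R : R[i]) != 0 by rewrite pnatr_eq0 -lt0n.
have mulE := @suffridge_mul_sqr R N j hj; rewrite /= -/c in mulE.
split=> [|z Dz_neq0].
  (* Its value at [0] is [1]. *)
  have D_neq0 : 1 - (2 * c) *: 'X + 'X^2 != 0 :> {poly R[i]}.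
    apply/eqP => /(congr1 (horner^~ 0)).
    by rewrite !hornerE expr0n subr0 addr0 => /eqP; rewrite oner_eq0.
  rewrite -mulE rmorphM mulfK //.
  by rewrite tofrac_eq0 scaler_eq0 negb_or N_neq0 expf_neq0.
rewrite mulrA; apply: (canRL (mulfK _)); first by rewrite mulf_neq0 ?expf_neq0.
by move/(congr1 (horner^~ z)): mulE; rewrite !hornerE hornerMn hornerC.
Qed.
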